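(* Let $\kappa$ be an infinite cardinal and let $(X_\alpha)_{\alpha\in A}$ be a family of ${\downarrow}\kappa$-complete topologized posets. Then the Tychonoff product $X:=\prod_{\alpha\in A}X_\alpha$ is a ${\downarrow}\kappa$-complete topologized poset.
   Context: A topologized poset is a partially ordered set $(X,\le)$ endowed with a topology (no compatibility between order and topology is assumed). $\overline{D}$ denotes the closure of $D$. A subset $D\subseteq X$ is down-directed if for any $x,y\in D$ there is $z\in D$ with $z\le x$ and $z\le y$. For a cardinal $\kappa$, a topologized poset $X$ is ${\downarrow}\kappa$-complete if each nonempty down-directed set $D\subseteq X$ of cardinality $|D|\le\kappa$ has a greatest lower bound $\inf D$ in $X$ and $\inf D\in\overline{D}$. The Tychonoff product $\prod_{\alpha\in A}X_\alpha$ of topologized posets $(X_\alpha,\le_\alpha)$ carries the product topology and the pointwise partial order: $(x_\alpha)_{\alpha\in A}\le(y_\alpha)_{\alpha\in A}$ iff $x_\alpha\le_\alpha y_\alpha$ for each $\alpha\in A$. *)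

(* Defs.v *)
From HB Require Import structures.
From mathcomp Require Import all_boot all_order.
From mathcomp Require Import boolp classical_sets functions cardinality.
From mathcomp Require Import topology.

Set Implicit Arguments.
Unset Strict Implicit.
Unset Printing Implicit Defensive.

Import Order.TTheory.

Local Open Scope classical_set_scope.
Local Open Scope card_scope.

(* [POrderedTopological] is the join of the two structures, with no
   compatibility axiom between order and topology. *)
Notation topologizedPosetType := POrderedTopological.type.

Definition down_directed (d : Order.disp_t) (T : porderType d) (D : set T) :=
  forall x y, D x -> D y -> exists z, [/\ D z, (z <= x)%O & (z <= y)%O].

(* The cardinal kappa is given by a type K of that cardinality. *)
Definition down_complete (K : Type) (d : Order.disp_t)
    (X : topologizedPosetType d) :=
  forall D : set X, D !=set0 -> down_directed D -> D #<= [set: K] ->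
    exists2 x, infimums D x & closure D x.

Section ProductPoset.
Variables (A : Type) (d : A -> Order.disp_t).
Variable X : forall a, topologizedPosetType (d a).

Definition prod_le (x y : prod_topology X) := `[< forall a, (x a <= y a)%O >].

Fact prod_le_refl : reflexive prod_le.
Proof. by move=> x; apply/asboolP => a. Qed.

Fact prod_le_anti : antisymmetric prod_le.
Proof.
move=> x y /andP[/asboolP xy /asboolP yx].
by apply: functional_extensionality_dep => a; apply/le_anti; rewrite xy yx.
Qed.

Fact prod_le_trans : transitive prod_le.
Proof.
move=> y x z /asboolP xy /asboolP yz; apply/asboolP => a.
exact: le_trans (xy a) (yz a).
Qed.

HB.instance Definition _ := Order.Le_isPOrder.Build FunOrder.fun_display
  (prod_topology X) prod_le_refl prod_le_anti prod_le_trans.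

Lemma prod_leP (x y : prod_topology X) :
  reflect (forall a, (x a <= y a)%O) (x <= y)%O.
Proof. exact: asboolP. Qed.

End ProductPoset.

(* Main.v *)
(** Along a down-directed set D of cardinality at most kappa, a monotone map f
    into a down-kappa-complete poset converges to inf f(D).  Otherwise some
    neighborhood U of the infimum would be missed by f on a coinitial subset C
    of D; but C is again directed, f(C) has the same infimum as f(D), and
    completeness puts this infimum in the closure of f(C), a contradiction.
    Convergence, unlike adherence, is checked coordinatewise in a product. *)

Require Import Defs.
From mathcomp Require Import all_boot all_order.
From mathcomp Require Import boolp classical_sets functions cardinality.
From mathcomp Require Import topology.

Import Order.TTheory.

Local Open Scope classical_set_scope.

(** The section filter of [D], viewed as a net running downwards and indexed by itself. *)
Definition tails {d : Order.disp_t} {I : porderType d} (D : set I) :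
    set_system I :=
  filter_from D (fun i => [set j | D j /\ (j <= i)%O]).

Lemma tails_proper_filter {d : Order.disp_t} {I : porderType d} (D : set I) :
  D !=set0 -> down_directed D -> ProperFilter (tails D).
Proof.
move=> D0 dirD; apply: filter_from_proper; last by move=> i Di; exists i; split.
apply: filter_from_filter => // i j Di Dj.
have [k [Dk ki kj]] := dirD i j Di Dj.
by exists k => // l [Dl lk]; split; split => //; exact: le_trans lk _.
Qed.

Lemma coinitial_directed {d : Order.disp_t} {I : porderType d} (D C : set I) :
  C `<=` D -> (forall i, D i -> exists2 j, C j & (j <= i)%O) ->
  down_directed D -> down_directed C.
Proof.
move=> CD coC dirD i j /CD Di /CD Dj.
have [k [Dk ki kj]] := dirD i j Di Dj.
have [l Cl lk] := coC k Dk.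
by exists l; split => //; exact: le_trans lk _.
Qed.

(** Every [f i] with [i] in [D] lies above some [f j] with [j] in [C], so both images have the same
    lower bounds. *)
Lemma coinitial_infimums {d d' : Order.disp_t} {I : porderType d}
    {T : porderType d'} (f : I -> T) (D C : set I) :
  {homo f : i j / (i <= j)%O} ->
  C `<=` D -> (forall i, D i -> exists2 j, C j & (j <= i)%O) ->
  infimums (f @` C) = infimums (f @` D).
Proof.
move=> fh CD coC; rewrite /infimums.
suff -> : lbound (f @` C) = lbound (f @` D) by [].
apply/seteqP; split => x xlb _ [i Xi <-]; last by apply: xlb; exists i => //; exact: CD.
have [j Cj ji] := coC i Xi.
by apply: le_trans (fh _ _ ji); apply: xlb; exists j.
Qed.

Lemma down_directed_image {d d' : Order.disp_t} {I : porderType d}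
    {T : porderType d'} (f : I -> T) (D : set I) :
  {homo f : i j / (i <= j)%O} -> down_directed D -> down_directed (f @` D).
Proof.
move=> fh dirD _ _ [i Di <-] [j Dj <-].
have [k [Dk ki kj]] := dirD i j Di Dj.
by exists (f k); split; [exists k | exact: fh | exact: fh].
Qed.

Lemma down_complete_cvg (K : Type) {d d' : Order.disp_t} {I : porderType d}
    {X : topologizedPosetType d'} (f : I -> X) (D : set I) :
  down_complete K X -> {homo f : i j / (i <= j)%O} ->
  D !=set0 -> down_directed D -> (D #<= [set: K])%card ->
  exists2 x, infimums (f @` D) x & f @ tails D --> x.
Proof.
move=> cX fh D0 dirD DK.
have inf_image C : C !=set0 -> down_directed C -> C `<=` D ->
    exists2 x, infimums (f @` C) x & closure (f @` C) x.
  move=> [i Ci] dirC CD; apply: cX; first by exists (f i); exists i.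
    exact: down_directed_image.
  apply: card_le_trans (card_image_le _ _) (card_le_trans _ DK).
  exact: subset_card_le.
have [x infx _] := inf_image D D0 dirD (@subset_refl _ D).
exists x => // U Ux; apply: contrapT => notU.
pose C := [set i | D i /\ ~ U (f i)].
have CD : C `<=` D by move=> i [].
have coC i : D i -> exists2 j, C j & (j <= i)%O.
  (* Otherwise [f] maps the whole tail of [D] below [i] into [U], which puts [U] in the image
     filter. *)
  move=> Di; apply: contrapT => noj; apply: notU; exists i => // j [Dj ji].
  by apply: contrapT => nUj; apply: noj; exists j.
have C0 : C !=set0 by case: D0 => i /coC[j Cj _]; exists j.
have [y infy cly] := inf_image C C0 (coinitial_directed _ _ CD coC dirD) CD.
have yx : y = x.
  apply: is_subset1_infimums infx.
  by rewrite -(coinitial_infimums f D C).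
by rewrite yx in cly; have [_ [[i [_ nUi] <-]]] := cly U Ux.
Qed.

(** The product topology is the supremum of the topologies induced by the projections, so it
    suffices to test preimages of open sets of a single factor. *)
Lemma prod_topology_cvg {I : Type} {T : I -> topologicalType}
    (F : set_system (prod_topology T)) (x : prod_topology T) :
  Filter F -> (forall i, (fun y : prod_topology T => y i) @ F --> x i) ->
  F --> x.
Proof.
move=> FF Fx; apply/cvg_sup => i U [V [[W oW <-] Wx WU]].
apply: filterS WU _; apply: (Fx i); exact: open_nbhs_nbhs.
Qed.

Theorem theorem3p2 (K : Type) (hK : infinite_set [set: K])
    (A : Type) (d : A -> Order.disp_t)
    (X : forall a : A, topologizedPosetType (d a))
    (hX : forall a : A, down_complete K (X a)) :
  down_complete K (prod_topology X).
Proof.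
move=> D D0 dirD DK.
(* The product itself is the index poset and the projections are the monotone maps, so the single
   filter [tails D] governs all coordinates. *)
have proj_homo a : {homo (fun y : prod_topology X => y a) : y z / (y <= z)%O}.
  by move=> y z /prod_leP.
have lim a := cid2 (down_complete_cvg K _ D (hX a) (proj_homo a) D0 dirD DK).
pose x : prod_topology X := fun a => s2val (lim a).
have FD := tails_proper_filter D D0 dirD.
exists x.
- split=> [y Dy|y ylb]; apply/prod_leP => a; have [xlb xglb] := s2valP (lim a).
  + by apply: xlb; exists y.
  + by apply: xglb => _ [z Dz <-]; exact/proj_homo/ylb.
- have Dx : tails D --> x by apply: prod_topology_cvg => a; exact: s2valP' (lim a).
  (* Both [D] and [U] belong to the proper filter [tails D], hence they meet. *)
  move=> U /Dx tU; have tD : tails D D.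
    by case: D0 => i Di; exists i => // j [].
  exact: filter_ex (filterI tD tU).
Qed.
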